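(* Let $(M,L)$ and $(M,\widetilde L)$ be conformally related Finsler manifolds with $\widetilde g=e^{2\sigma}g$, and assume that the conformal change is homothetic, i.e. $\sigma$ is constant. Then: (a) $(M,L)$ is $P_{2}$-like if and only if $(M,\widetilde{L})$ is $P_{2}$-like. (b) $(M,L)$ is $h$-isotropic if and only if $(M,\widetilde{L})$ is $h$-isotropic. (c) $(M,L)$ is of constant curvature if and only if $(M,\widetilde{L})$ is of constant curvature. (d) $(M,L)$ is of $p$-scalar curvature if and only if $(M,\widetilde{L})$ is of $p$-scalar curvature. (e) $(M,L)$ is of $s$-$ps$-curvature if and only if $(M,\widetilde{L})$ is of $s$-$ps$-curvature. (f) $(M,L)$ is $R_{3}$-like if and only if $(M,\widetilde{L})$ is $R_{3}$-like. (g) $(M,L)$ is symmetric if and only if $(M,\widetilde{L})$ is symmetric. (h) $(M,L)$ is $P$-symmetric if and only if $(M,\widetilde{L})$ is $P$-symmetric.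
   Context: $M$ is a real paracompact $C^\infty$ manifold of finite dimension $n$; all objects are $C^\infty$. $\pi:\mathcal{T}M\to M$ is the bundle of nonzero tangent vectors, $\pi^{-1}(TM)$ the pullback of $TM$ by $\pi$. Sections of $\pi^{-1}(TM)$ are called $\pi$-vector fields; $\pi$-forms are forms on $\pi^{-1}(TM)$; $\overline\eta(u)=(u,u)$. $\rho:T(\mathcal{T}M)\to\pi^{-1}(TM)$ is $\rho=(\pi_{\mathcal{T}M},d\pi)$ and $\gamma:\pi^{-1}(TM)\to T(\mathcal{T}M)$ is the vertical lift. For a linear connection $D$ on $\pi^{-1}(TM)$, $K(X):=D_X\overline\eta$; $D$ is regular if $T(\mathcal{T}M)=V(\mathcal{T}M)\oplus H(\mathcal{T}M)$ with $H=\ker K$, $V$ the vertical bundle, and then $\beta:=(\rho|_{H})^{-1}$. Torsion: $\mathbf{T}(X,Y)=D_X\rho Y-D_Y\rho X-\rho[X,Y]$, $Q(\overline X,\overline Y)=\mathbf{T}(\beta\overline X,\beta\overline Y)$, $T(\overline X,\overline Y)=\mathbf{T}(\gamma\overline X,\beta\overline Y)$. Curvature: $\mathbf{K}(X,Y)\rho Z=-D_XD_Y\rho Z+D_YD_X\rho Z+D_{[X,Y]}\rho Z$, with $R(\overline X,\overline Y)\overline Z=\mathbf{K}(\beta\overline X,\beta\overline Y)\overline Z$, $P(\overline X,\overline Y)\overline Z=\mathbf{K}(\beta\overline X,\gamma\overline Y)\overline Z$, $\widehat P(\overline X,\overline Y)=P(\overline X,\overline Y)\overline\eta$. $(M,L)$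 is a Finsler manifold with Finsler metric $g$ on $\pi^{-1}(TM)$. The Cartan connection $\nabla$ is the unique regular connection with $\nabla g=0$, $Q=0$ and $g(T(\overline X,\overline Y),\overline Z)=g(T(\overline X,\overline Z),\overline Y)$; $T,R,P,K,\beta$ are those of $\nabla$. $T(\overline X,\overline Y,\overline Z):=g(T(\overline X,\overline Y),\overline Z)$, $R(\overline X,\overline Y,\overline Z,\overline W):=g(R(\overline X,\overline Y)\overline Z,\overline W)$, $P(\overline X,\overline Y,\overline Z,\overline W):=g(P(\overline X,\overline Y)\overline Z,\overline W)$. The Berwald connection is $D^\circ_X\overline Y=\nabla_X\overline Y+\widehat P(\rho X,\overline Y)-T(KX,\overline Y)$ (same $\beta$), with h-curvature $R^\circ$. $\ell(\overline X):=L^{-1}g(\overline X,\overline\eta)$; $\hbar:=g-\ell\otimes\ell$; $\phi(\overline X):=\overline X-L^{-1}\ell(\overline X)\overline\eta$. $Ric^h(\overline X,\overline Y):=\mathrm{Tr}\{\overline Z\mapsto R(\overline X,\overline Z)\overline Y\}$; $g(Ric^h_0(\overline X),\overline Y):=Ric^h(\overline X,\overline Y)$; $Sc^h:=\mathrm{Tr}\{\overline X\mapsto Ric^h_0(\overline X)\}$. $(M,L)$ is: - $P_2$-like ($\dim M\ge3$) if $P(\overline X,\overline Y,\overline Z,\overline W)=\alpha(\overline Z)T(\overline X,\overline Y,\overline W)-\alpha(\overline W)T(\overline X,\overline Y,\overline Z)$ for some $\pi$-form $\alpha$ of order one, positively homogeneous of degree $0$; - $h$-isotropic ($\dim M\ge3$)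 if there is a scalar $k_o$ with $R(\overline X,\overline Y)\overline Z=k_o\{g(\overline X,\overline Z)\overline Y-g(\overline Y,\overline Z)\overline X\}$; - of scalar curvature ($\dim M\ge3$) if there is a function $k:\mathcal{T}M\to\mathbb{R}$ with $R(\overline\eta,\overline X,\overline\eta,\overline Y)=kL^2\hbar(\overline X,\overline Y)$; of constant curvature if moreover $k$ is constant; - of $p$-scalar (perpendicular scalar) curvature if $R(\phi(\overline X),\phi(\overline Y),\phi(\overline Z),\phi(\overline W))=R_o\{\hbar(\overline X,\overline Z)\hbar(\overline Y,\overline W)-\hbar(\overline X,\overline W)\hbar(\overline Y,\overline Z)\}$ for some function $R_o$ on $TM$; - of $s$-$ps$-curvature if it is both of scalar curvature and of $p$-scalar curvature; - $R_3$-like if $\dim M\ge4$ and $R(\overline X,\overline Y,\overline Z,\overline W)=g(\overline X,\overline Z)F(\overline Y,\overline W)-g(\overline Y,\overline Z)F(\overline X,\overline W)+g(\overline Y,\overline W)F(\overline X,\overline Z)-g(\overline X,\overline W)F(\overline Y,\overline Z)$, with $F=\frac{1}{n-2}\{Ric^h-\frac{Sc^h\,g}{2(n-1)}\}$; - symmetric if $D^\circ_{\beta\overline X}R^\circ=0$ for all $\overline X$; - $P$-symmetric if $P(\overline X,\overline Y)\overline Z=P(\overline Y,\overline X)\overline Z$ for all $\overline X,\overline Y,\overline Z$. $(M,L)$ and $(M,\widetilde L)$ are conformally related if $\widetilde g=e^{2\sigma(x)}g$ (equivalently $\widetilde L^2=e^{2\sigma(x)}L^2$) for a positive differentiable function $\sigma$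 on $M$. *)

(* Defs.v *)
From HB Require Import structures.
From mathcomp Require Import all_boot all_order all_algebra.
From mathcomp Require Import all_classical all_reals all_analysis.

Set Implicit Arguments.
Unset Strict Implicit.
Unset Printing Implicit Defensive.

Import Order.TTheory GRing.Theory Num.Theory.
Import numFieldNormedType.Exports.

Local Open Scope classical_set_scope.
Local Open Scope ring_scope.

(* C^k on U: k = 0 is continuity at every point of U; C^k.+1 asks for all
   partial derivatives to exist on U and to be C^k there. U is meant open. *)
Fixpoint Ck_on (R : realType) (m : nat) (k : nat) (U : set 'rV[R]_m)
    (f : 'rV[R]_m -> R) : Prop :=
  (forall x, U x -> {for x, continuous f}) /\
  if k is k'.+1 then
    (forall i x, U x -> derivable f x (delta_mx 0 i)) /\
    (forall i, Ck_on k' U (fun x => 'D_(delta_mx 0 i) f x))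
  else True.

Definition smooth_on (R : realType) (m : nat) (U : set 'rV[R]_m)
  (f : 'rV[R]_m -> R) := forall k, Ck_on k U f.

Definition paracompact (T : topologicalType) :=
  forall C : set (set T),
    (forall A, C A -> open A) -> (forall x, exists2 A, C A & A x) ->
  exists C' : set (set T),
    [/\ forall A, C' A -> open A, forall x, exists2 A, C' A & A x,
        forall A, C' A -> exists2 B, C B & A `<=` B
      & forall x : T, exists2 N, nbhs x N &
          finite_set [set A | C' A /\ A `&` N !=set0]].

(* [cmap] is only meaningful on [cdom], [cinv] only on [cimg]. *)
Record chart (R : realType) (n : nat) (T : topologicalType) := Chart {
  cdom : set T;
  cmap : T -> 'rV[R]_n;
  cinv : 'rV[R]_n -> T }.

Definition cimg (R : realType) n (T : topologicalType) (c : chart R n T) :=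
  cmap c @` cdom c.

Definition is_chart (R : realType) n (T : topologicalType)
    (c : chart R n T) :=
  [/\ open (cdom c), open (cimg c), forall p, cdom c p -> cinv c (cmap c p) = p,
      forall p, cdom c p -> {for p, continuous (cmap c)}
    & forall x, cimg c x -> {for x, continuous (cinv c)}].

Record manifold (R : realType) (n : nat) := Manifold {
  point_of :> topologicalType;
  atlas : set (chart R n point_of);
  manifold_hausdorff : hausdorff_space point_of;
  manifold_paracompact : paracompact point_of;
  atlas_chart : forall c, atlas c -> is_chart c;
  atlas_cover : forall p, exists2 c, atlas c & cdom c p;
  atlas_smooth : forall c d, atlas c -> atlas d -> forall i,
    smooth_on (cmap c @` (cdom c `&` cdom d))
              (fun x => cmap d (cinv c x) 0 i) }.

(* Derivations at p of an algebra C of real functions; v is required to vanish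
   off C so that a derivation is determined by its values on C. *)
Definition derivation_at (R : realType) (T : Type) (C : set (T -> R)) (p : T)
    (v : (T -> R) -> R) :=
  [/\ forall a f g, C f -> C g -> v (fun x => a * f x + g x) = a * v f + v g,
      forall f g, C f -> C g ->
        v (fun x => f x * g x) = f p * v g + v f * g p
    & forall f, ~ C f -> v f = 0].

Section SlitTangentBundle.
Variables (R : realType) (n : nat) (M : manifold R n).

Definition smooth (f : M -> R) :=
  forall c, atlas c -> smooth_on (cimg c) (f \o cinv c).

(* Tangent vectors of M live in the vector space (M -> R) -> R, the fibre T_p M
   being the subspace of derivations at p of C^oo(M). *)
Definition tvec := (M -> R) -> R.

Definition tangent (p : M) : set tvec := derivation_at smooth p.

(* The space of nonzero tangent vectors. *)
Definition slit_set : set (M * tvec) :=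
  [set u | tangent u.1 u.2 /\ u.2 <> 0].

Definition slit : Type := slit_set.

Definition base (u : slit) : M := (val u).1.
Definition vec (u : slit) : tvec := (val u).2.

Definition ext (F : slit -> R) (p : M) (v : tvec) : R :=
  oapp F 0 (insub (p, v)).

(* \sum_i y_i d/dx^i at p in the chart c *)
Definition coordvec (c : chart R n M) (p : M) (y : 'rV[R]_n) : tvec :=
  fun f => if `[< smooth f >] then 'D_y (f \o cinv c) (cmap c p) else 0.

(* Smoothness in the coordinates (x, y) that each chart of M induces. *)
Definition smooth_slit (F : slit -> R) :=
  forall c, atlas c ->
    smooth_on [set z : 'rV[R]_(n + n) | cimg c (lsubmx z) /\ rsubmx z <> 0]
      (fun z => let p := cinv c (lsubmx z) in ext F p (coordvec c p (rsubmx z))).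

(* T_u(TTM) *)
Definition tvec2 := (slit -> R) -> R.

Definition tangent2 (u : slit) : set tvec2 := derivation_at smooth_slit u.

Definition vfield (X : slit -> tvec2) :=
  (forall u, tangent2 u (X u)) /\
  (forall F, smooth_slit F -> smooth_slit (fun u => X u F)).

Definition pifield (X : slit -> tvec) :=
  (forall u, tangent (base u) (X u)) /\
  (forall f, smooth f -> smooth_slit (fun u => X u f)).

Definition eta : slit -> tvec := vec.

Definition bracket (X Y : slit -> tvec2) : slit -> tvec2 :=
  fun u F => X u (fun w => Y w F) - Y u (fun w => X w F).

Definition rho (xi : tvec2) : tvec :=
  fun f => if `[< smooth f >] then xi (f \o base) else 0.

Definition gamma (u : slit) (v : tvec) : tvec2 :=
  fun F => if `[< smooth_slit F >] then
             derive1 (fun t : R => ext F (base u) (vec u + t *: v)) 0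
           else 0.

Definition rhof (X : slit -> tvec2) : slit -> tvec := fun u => rho (X u).
Definition gammaf (X : slit -> tvec) : slit -> tvec2 := fun u => gamma u (X u).

(* Connections are functions on all maps, of which only the values on vector
   fields and pi-vector fields matter. *)
Definition connection := (slit -> tvec2) -> (slit -> tvec) -> slit -> tvec.

Definition linear_connection (D : connection) :=
  [/\ forall X Y, vfield X -> pifield Y -> pifield (D X Y),
      forall F X X' Y, smooth_slit F -> vfield X -> vfield X' -> pifield Y ->
        forall u, D (fun w => F w *: X w + X' w) Y u =
                  F u *: D X Y u + D X' Y u,
      forall X Y Y', vfield X -> pifield Y -> pifield Y' ->
        forall u, D X (fun w => Y w + Y' w) u = D X Y u + D X Y' u
    & forall F X Y, smooth_slit F -> vfield X -> pifield Y ->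
        forall u, D X (fun w => F w *: Y w) u =
                  X u F *: Y u + F u *: D X Y u].

Definition Kmap (D : connection) (X : slit -> tvec2) : slit -> tvec := D X eta.

Definition vertical (u : slit) : set tvec2 :=
  [set xi | tangent2 u xi /\ rho xi = 0].

(* Kernel at u of the bundle map induced by Kmap. *)
Definition horizontal (D : connection) (u : slit) : set tvec2 :=
  [set xi | exists X, [/\ vfield X, X u = xi & Kmap D X u = 0]].

Definition regular (D : connection) := forall u,
  (forall xi, tangent2 u xi ->
     exists v h, [/\ vertical u v, horizontal D u h & xi = v + h]) /\
  (forall xi, vertical u xi -> horizontal D u xi -> xi = 0).

Definition beta (D : connection) (u : slit) (v : tvec) : tvec2 :=
  get [set xi | horizontal D u xi /\ rho xi = v].

Definition betaf (D : connection) (X : slit -> tvec) : slit -> tvec2 :=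
  fun u => beta D u (X u).

Definition torsion (D : connection) (X Y : slit -> tvec2) : slit -> tvec :=
  fun u => D X (rhof Y) u - D Y (rhof X) u - rhof (bracket X Y) u.

Definition Qtor (D : connection) (X Y : slit -> tvec) :=
  torsion D (betaf D X) (betaf D Y).
Definition Ttor (D : connection) (X Y : slit -> tvec) :=
  torsion D (gammaf X) (betaf D Y).

Definition curv (D : connection) (X Y : slit -> tvec2) (Z : slit -> tvec) :
    slit -> tvec :=
  fun u => - D X (D Y Z) u + D Y (D X Z) u + D (bracket X Y) Z u.

Definition Rcurv (D : connection) (X Y Z : slit -> tvec) :=
  curv D (betaf D X) (betaf D Y) Z.
Definition Pcurv (D : connection) (X Y Z : slit -> tvec) :=
  curv D (betaf D X) (gammaf Y) Z.
Definition Phat (D : connection) (X Y : slit -> tvec) := Pcurv D X Y eta.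

(* Frames of the pullback bundle around u, used for traces. *)
Definition frame_at (u : slit) (e : 'I_n -> slit -> tvec) :=
  (forall i, pifield (e i)) /\
  (forall v, tangent (base u) v ->
     exists! a : 'rV[R]_n, v = \sum_i a 0 i *: e i u).

Definition frame (u : slit) : 'I_n -> slit -> tvec := get (frame_at u).

Definition coord (u : slit) (e : 'I_n -> slit -> tvec) (v : tvec) : 'rV[R]_n :=
  xget (0 : 'rV[R]_n) [set a : 'rV[R]_n |
    frame_at u e /\ v = \sum_i a 0 i *: e i u].

(* Trace at u of the endomorphism of the fibre at u induced by a C^oo-linear
   operator on pi-vector fields, computed in a frame. *)
Definition trace (A : (slit -> tvec) -> slit -> tvec) (u : slit) : R :=
  \sum_i coord u (frame u) (A (frame u i) u) 0 i.

Definition fibre_metric (g : slit -> tvec -> tvec -> R) :=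
  [/\ forall u a v v' w, tangent (base u) v -> tangent (base u) v' ->
        tangent (base u) w -> g u (a *: v + v') w = a * g u v w + g u v' w,
      forall u v w, tangent (base u) v -> tangent (base u) w ->
        g u v w = g u w v,
      forall u v, tangent (base u) v -> v <> 0 -> 0 < g u v v
    & forall X Y, pifield X -> pifield Y ->
        smooth_slit (fun u => g u (X u) (Y u))].

End SlitTangentBundle.

Section Finsler.
Variables (R : realType) (n : nat) (M : manifold R n).
Implicit Types (L : M -> tvec M -> R) (X Y Z W : slit M -> tvec M).

(* Only the values of L on tangent vectors matter. *)

(* Half the Hessian of L^2 along the fibre, a form on the tangent space at
   base u; it is extended by 0 to vectors of the ambient space tvec M that are
   not tangent at base u. *)
Definition fmetric L (u : slit M) (v w : tvec M) : R :=
  if `[< tangent (base u) v /\ tangent (base u) w >] then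
    2^-1 * derive1 (fun s : R => derive1 (fun t : R =>
      L (base u) (vec u + s *: v + t *: w) ^+ 2) 0) 0
  else 0.

Definition Lf L (u : slit M) : R := L (base u) (vec u).

Definition finsler L :=
  [/\ smooth_slit (Lf L), forall u, 0 < Lf L u,
      forall p v a, tangent p v -> 0 < a -> L p (a *: v) = a * L p v
    & fibre_metric (fmetric L)].

Definition gf L X Y (u : slit M) : R := fmetric L u (X u) (Y u).

Definition is_cartan L (D : connection M) :=
  [/\ linear_connection D, regular D,
      forall (X : slit M -> tvec2 M) Y Z, vfield X -> pifield Y -> pifield Z ->
        forall u, X u (gf L Y Z) = gf L (D X Y) Z u + gf L Y (D X Z) u,
      forall X Y, pifield X -> pifield Y -> forall u, Qtor D X Y u = 0
    & forall X Y Z, pifield X -> pifield Y -> pifield Z ->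
        forall u, gf L (Ttor D X Y) Z u = gf L (Ttor D X Z) Y u].

(* The Cartan connection: the unique solution of [is_cartan] (unique up to its
   irrelevant values outside vector fields and pi-vector fields). *)
Definition cartan L : connection M := get (is_cartan L).

Definition T3 L X Y Z := gf L (Ttor (cartan L) X Y) Z.
Definition R4 L X Y Z W := gf L (Rcurv (cartan L) X Y Z) W.
Definition P4 L X Y Z W := gf L (Pcurv (cartan L) X Y Z) W.

Definition berwald L : connection M :=
  fun (X : slit M -> tvec2 M) Y u =>
  cartan L X Y u + Phat (cartan L) (rhof X) Y u
  - Ttor (cartan L) (Kmap (cartan L) X) Y u.

(* The Berwald connection has the same beta as the Cartan connection. *)
Definition Rberwald L X Y Z :=
  curv (berwald L) (betaf (cartan L) X) (betaf (cartan L) Y) Z.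

Definition ell L X (u : slit M) : R := (Lf L u)^-1 * gf L X (@eta _ _ M) u.
Definition hbar L X Y (u : slit M) : R := gf L X Y u - ell L X u * ell L Y u.
Definition phi L X (u : slit M) : tvec M :=
  X u - ((Lf L u)^-1 * ell L X u) *: eta u.

Definition Rich L X Y : slit M -> R :=
  trace (fun Z => Rcurv (cartan L) X Z Y).

Definition Rich0 L X : slit M -> tvec M :=
  xget (fun _ => 0) [set W | pifield W /\
    forall Y, pifield Y -> forall u, gf L W Y u = Rich L X Y u].

Definition Sch L : slit M -> R := trace (Rich0 L).

Definition pi_one_form (alpha : slit M -> tvec M -> R) :=
  (forall u a v w, tangent (base u) v -> tangent (base u) w ->
     alpha u (a *: v + w) = a * alpha u v + alpha u w) /\
  (forall X, pifield X -> smooth_slit (fun u => alpha u (X u))).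

Definition homogeneous0 (alpha : slit M -> tvec M -> R) :=
  forall (u u' : slit M) a, 0 < a -> base u' = base u -> vec u' = a *: vec u ->
    forall v, tangent (base u) v -> alpha u' v = alpha u v.

Definition P2_like L :=
  (3 <= n)%N /\
  exists alpha, [/\ pi_one_form alpha, homogeneous0 alpha
    & forall X Y Z W, pifield X -> pifield Y -> pifield Z -> pifield W ->
        forall u, P4 L X Y Z W u =
          alpha u (Z u) * T3 L X Y W u - alpha u (W u) * T3 L X Y Z u].

Definition h_isotropic L :=
  (3 <= n)%N /\
  exists2 k : slit M -> R, smooth_slit k &
    forall X Y Z, pifield X -> pifield Y -> pifield Z -> forall u,
      Rcurv (cartan L) X Y Z u =
        k u *: (gf L X Z u *: Y u - gf L Y Z u *: X u).

Definition has_curvature L (k : slit M -> R) :=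
  forall X Y, pifield X -> pifield Y -> forall u,
    R4 L (@eta _ _ M) X (@eta _ _ M) Y u = k u * Lf L u ^+ 2 * hbar L X Y u.

Definition scalar_curvature L :=
  (3 <= n)%N /\ exists2 k, smooth_slit k & has_curvature L k.

Definition constant_curvature L :=
  (3 <= n)%N /\ exists k : R, has_curvature L (fun _ => k).

Definition p_scalar_curvature L :=
  exists2 Ro : slit M -> R, smooth_slit Ro &
    forall X Y Z W, pifield X -> pifield Y -> pifield Z -> pifield W ->
      forall u, R4 L (phi L X) (phi L Y) (phi L Z) (phi L W) u =
        Ro u * (hbar L X Z u * hbar L Y W u - hbar L X W u * hbar L Y Z u).

Definition s_ps_curvature L := scalar_curvature L /\ p_scalar_curvature L.

Definition Ften L X Y (u : slit M) : R :=
  (n%:R - 2)^-1 *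
  (Rich L X Y u - Sch L u * gf L X Y u / (2 * (n%:R - 1))).

Definition R3_like L :=
  (4 <= n)%N /\
  forall X Y Z W, pifield X -> pifield Y -> pifield Z -> pifield W ->
    forall u, R4 L X Y Z W u =
      gf L X Z u * Ften L Y W u - gf L Y Z u * Ften L X W u
      + gf L Y W u * Ften L X Z u - gf L X W u * Ften L Y Z u.

(* Covariant derivative along X of the tensor S. *)
Definition cov3 (D : connection M)
    (S : (slit M -> tvec M) -> (slit M -> tvec M) -> (slit M -> tvec M) ->
         slit M -> tvec M)
    (X : slit M -> tvec2 M) Y Z W (u : slit M) : tvec M :=
  D X (S Y Z W) u - S (D X Y) Z W u - S Y (D X Z) W u - S Y Z (D X W) u.

Definition symmetric_finsler L :=
  forall X Y Z W, pifield X -> pifield Y -> pifield Z -> pifield W ->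
    forall u, cov3 (berwald L) (Rberwald L) (betaf (cartan L) X) Y Z W u = 0.

Definition P_symmetric L :=
  forall X Y Z, pifield X -> pifield Y -> pifield Z ->
    forall u, Pcurv (cartan L) X Y Z u = Pcurv (cartan L) Y X Z u.

Definition conformal (sigma : M -> R) L L' :=
  [/\ smooth sigma, forall p, 0 < sigma p
    & forall (u : slit M) v w, tangent (base u) v -> tangent (base u) w ->
        fmetric L' u v w = expR (2 * sigma (base u)) * fmetric L u v w].

Definition homothetic (sigma : M -> R) := exists s, forall p, sigma p = s.

End Finsler.

(* Main.v *)
(* A homothetic change multiplies the Finsler metric by the constant
   c = exp(2 sigma). The equations defining the Cartan connection are homogeneous
   in the metric, so both Finsler structures have the same Cartan and Berwald
   connections, and the same (1,3)-curvatures. By Euler's theorem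
   L^2 = g(eta, eta), so L^2 and hbar are multiplied by c while phi is unchanged;
   Ric^h and F are unchanged and Sc^h is divided by c. Each class is therefore
   preserved, with scalars such as k_o, k and R_o divided by c, and the converse
   implications follow by exchanging c with 1/c. *)
Require Import Defs.
From mathcomp Require Import all_boot all_order all_algebra.
From mathcomp Require Import all_classical all_reals all_analysis.
From mathcomp Require Import ring.

Set Implicit Arguments.
Unset Strict Implicit.
Unset Printing Implicit Defensive.

Import Order.TTheory GRing.Theory Num.Theory.
Import numFieldNormedType.Exports.

Local Open Scope classical_set_scope.
Local Open Scope ring_scope.

(** * Constant factors in directional derivatives, in C^k functions and in derivations *)

(* No differentiability of [f] is needed: where the limit does not exist, both
   sides take the junk value 0. *)
Lemma derive_scale (R : realType) (V : normedModType R) (c : R) (f : V -> R)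
    (x v : V) :
  'D_v (fun y => c * f y) x = c * 'D_v f x.
Proof.
have [->|c0] := eqVneq c 0.
  under eq_fun do rewrite mul0r.
  by rewrite mul0r derive_cst.
have [df|ndf] := pselect (derivable f x v); first exact: deriveZ.
have nd : ~ derivable (fun y => c * f y) x v.
  move=> /(@derivableZ _ _ _ _ c^-1 _ _) d; apply: ndf.
  rewrite (_ : f = c^-1 \*: (fun y => c * f y)) //.
  by apply/funext => y /=; rewrite /GRing.scale /= mulKf.
rewrite [LHS](dvgP nd) [in RHS](_ : 'D_v f x = 0) ?mulr0 //.
exact: (dvgP ndf).
Qed.

Lemma Ck_on_scale (R : realType) (m k : nat) (U : set 'rV[R]_m) (c : R)
    (f : 'rV[R]_m -> R) :
  Ck_on k U f -> Ck_on k U (fun x => c * f x).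
Proof.
elim: k f => [|k IH] f /= [fC fD]; split=> //.
- by move=> x Ux; apply: (cvgZl_tmp (fC x Ux)).
- by move=> x Ux; apply: (cvgZl_tmp (fC x Ux)).
case: fD => fD fk; split=> [i x Ux|i]; first exact: derivableZ (fD i x Ux).
under eq_fun do rewrite derive_scale.
exact: IH (fk i).
Qed.

Lemma derivation_at_lin (R : realType) (T : Type) (C : set (T -> R)) (p : T)
    (a : R) (v w : (T -> R) -> R) :
  derivation_at C p v -> derivation_at C p w -> derivation_at C p (a *: v + w).
Proof.
move=> [v1 v2 v3] [w1 w2 w3]; split.
- move=> b f g Cf Cg; rewrite !fctE /= v1 // w1 // /GRing.scale /=; ring.
- move=> f g Cf Cg; rewrite !fctE /= v2 // w2 // /GRing.scale /=; ring.
- by move=> f Cf; rewrite !fctE /= v3 // w3 // scaler0 addr0.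
Qed.

Lemma derivation_at_scale (R : realType) (T : Type) (C : set (T -> R)) (p : T)
    (a : R) (v : (T -> R) -> R) (f : T -> R) :
  derivation_at C p v -> C f -> v (fun x => a * f x) = a * v f.
Proof.
move=> [v1 _ _] Cf.
(* Linearity is available only as a f + g with both functions in [C]; taking g = f with coefficient
   a - 1 stays inside [C]. *)
rewrite (_ : (fun x => a * f x) = fun x => (a - 1) * f x + f x).
  by rewrite v1 //; ring.
by apply/funext => x; ring.
Qed.

(** * Tangent vectors, pi-vector fields and traces under scaling *)

Section SlitTangentBundle.
Variables (R : realType) (n : nat) (M : manifold R n).
Implicit Types (X Y Z W : slit M -> tvec M) (u : slit M).

Lemma smooth_slit_scale (c : R) (F : slit M -> R) :
  smooth_slit F -> smooth_slit (fun u => c * F u).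
Proof.
move=> sF ch ach k.
rewrite (_ : (fun z => _) = fun z => c * (let p := cinv ch (lsubmx z) in
  ext F p (coordvec ch p (rsubmx z)))); first exact/Ck_on_scale/sF.
(* Where [insub] fails, [ext] is 0 by default, and scaling fixes 0. *)
by apply/funext => z /=; rewrite /ext; case: insub => //=; rewrite mulr0.
Qed.

Lemma tangent_lin (p : M) (a : R) (v w : tvec M) :
  tangent p v -> tangent p w -> tangent p (a *: v + w).
Proof. exact: derivation_at_lin. Qed.

Lemma tangent0 (p : M) : tangent p (0 : tvec M).
Proof.
have E f : (0 : tvec M) f = 0 by [].
by split=> *; rewrite !E ?mulr0 ?mul0r ?addr0.
Qed.

Lemma tangent_scale (p : M) (a : R) (v : tvec M) :
  tangent p v -> tangent p (a *: v).
Proof. by move=> tv; rewrite -[_ *: v]addr0; apply/tangent_lin/tangent0. Qed.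

Lemma tangent_sum (p : M) (a : 'I_n -> R) (e : 'I_n -> tvec M) :
  (forall i, tangent p (e i)) -> tangent p (\sum_i a i *: e i).
Proof.
move=> te; elim/big_ind: _ => [|v w tv tw|i _]; first exact: tangent0.
  by rewrite -[v]scale1r; exact: tangent_lin.
exact: tangent_scale.
Qed.

Lemma tangent_vec u : tangent (base u) (vec u).
Proof. by case: u => -[p v] /= hv; move: (set_mem hv) => []. Qed.

Lemma pifield_scale (c : R) X : pifield X -> pifield (fun u => c *: X u).
Proof.
move=> [tX sX]; split=> [u|f sf]; first exact/tangent_scale/tX.
exact/smooth_slit_scale/sX.
Qed.

(** Multiplication by c and by 1/c matches the coordinate vectors of v with those of c v. If there
    are none, both sides are the default 0. *)
Lemma coord_scale u (e : 'I_n -> slit M -> tvec M) (c : R) (v : tvec M) :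
  c != 0 -> Defs.coord u e (c *: v) = c *: Defs.coord u e v.
Proof.
move=> c0; rewrite /Defs.coord.
have sub (d : R) w (a : 'rV[R]_n) : frame_at u e /\ w = \sum_i a 0 i *: e i u ->
    frame_at u e /\ d *: w = \sum_i (d *: a : 'rV[R]_n) 0 i *: e i u.
  move=> [fe ->]; split=> //; rewrite scaler_sumr.
  by apply: eq_bigr => i _; rewrite mxE scalerA.
case: (xgetP 0 [set a : 'rV[R]_n | frame_at u e /\ v = \sum_i a 0 i *: e i u]).
  move=> a _ va; apply: xget_unique; first exact: sub.
  move=> b [fe vb].
  (* A frame gives unique coordinates only to tangent vectors; c v is one, being a combination of
     frame vectors. *)
  have tcv : tangent (base u) (c *: v).
    by rewrite vb; apply: tangent_sum => i; case: (fe.1 i).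
  have [a' [_ a'P]] := fe.2 _ tcv.
  by rewrite -(a'P _ vb) -(a'P _ (sub c _ _ va).2).
move=> nv; rewrite xgetPN ?scaler0 // => a /(sub c^-1).
by rewrite scalerA mulVf // scale1r => /nv.
Qed.

Lemma trace_scale (c : R) (A : (slit M -> tvec M) -> slit M -> tvec M) u :
  c != 0 -> trace (fun X w => c *: A X w) u = c * trace A u.
Proof.
move=> c0; rewrite /trace mulr_sumr; apply: eq_bigr => i _.
by rewrite coord_scale // mxE.
Qed.

End SlitTangentBundle.

(** * Euler's theorem and nondegeneracy of the metric *)

(** Positive homogeneity makes L^2 quadratic along the ray of eta only while the factor stays
    positive, hence an equality merely near x. *)
Lemma derive1_sqr_shift (R : realType) (a b x : R) (f : R -> R) :
  (\forall t \near x, f t = b * (a + t) ^+ 2) ->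
  derive1 f x = b * (2 * (a + x)).
Proof.
move=> fE; rewrite derive1E (near_eq_derive _ fE) derive_scale.
congr (_ * _).
have := @deriveX _ _ (fun t : R => a + t) 2 x 1 (ltac:(exact: derivableD)).
rewrite fctE => ->; rewrite deriveD // derive_cst derive_id add0r.
by rewrite /GRing.scale /= mulr1 expr1 mulr_natl.
Qed.

Lemma near0_gt (R : realType) (a : R) :
  0 < a -> \forall t \near (0 : R), 0 < a + t.
Proof.
move=> a0; have na0 : - a < 0 by rewrite oppr_lt0.
by apply: filterS (lt_nbhsr na0) => t; rewrite -subr_gt0 opprK addrC.
Qed.

Section Finsler.
Variables (R : realType) (n : nat) (M : manifold R n).
Implicit Types (L : M -> tvec M -> R) (X Y Z W : slit M -> tvec M).
Implicit Types (u : slit M).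

(* Euler's theorem for the 2-homogeneous function L^2. *)
Lemma fmetric_vec L u : finsler L -> fmetric L u (vec u) (vec u) = Lf L u ^+ 2.
Proof.
move=> [_ _ hom _]; rewrite /fmetric asboolT; last by split; exact: tangent_vec.
have inner (s : R) : 0 < 1 + s ->
    derive1 (fun t : R =>
      L (base u) (vec u + s *: vec u + t *: vec u) ^+ 2) 0 =
    Lf L u ^+ 2 * (2 * (1 + s)).
  move=> s0; rewrite (@derive1_sqr_shift _ (1 + s) (Lf L u ^+ 2)) ?addr0 //.
  near=> t; rewrite -[X in X + _ *: _ + _]scale1r -!scalerDl hom //.
  - by rewrite exprMn mulrC.
  - exact: tangent_vec.
  - by near: t; exact: near0_gt.
rewrite derive1E (@near_eq_derive _ _ _ _
  (fun s : R => Lf L u ^+ 2 * (2 * (1 + s)))); last first.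
  near=> s; apply: inner; near: s; exact: near0_gt.
(* The outer derivative is 2 L^2; the factor 1/2 of [fmetric] cancels the 2. *)
rewrite !derive_scale deriveD // derive_cst derive_id add0r mulr1 mulrCA.
by rewrite mulVf ?mulr1.
Unshelve. all: by end_near.
Qed.

Lemma fmetric_scale L u (a : R) (v w : tvec M) : finsler L ->
  tangent (base u) v -> tangent (base u) w ->
  fmetric L u (a *: v) w = a * fmetric L u v w.
Proof.
move=> [_ _ _ [lin _ _ _]] tv tw.
have -> : a *: v = (a - 1) *: v + v by rewrite scalerBl scale1r subrK.
by rewrite lin //; ring.
Qed.

(** Positive definiteness is applied to the difference of the two fields at each point. This makes
    the field representing Ric^h unique. *)
Lemma gf_inj L W W' : finsler L -> pifield W -> pifield W' ->
  (forall Y, pifield Y -> forall u, gf L W Y u = gf L W' Y u) -> W = W'.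
Proof.
move=> [_ _ _ [lin sym pos _]] pW pW' gWW'; apply/funext => u.
have [tW tW'] := (pW.1 u, pW'.1 u).
have td := tangent_lin (-1) tW' tW.
have [d0|/eqP d0] := eqVneq (-1 *: W' u + W u) 0.
  by apply/eqP; rewrite -subr_eq0 -d0 scaleN1r addrC.
have := pos _ _ td d0.
have gd Y : pifield Y -> fmetric L u (-1 *: W' u + W u) (Y u) = 0.
  move=> pY; rewrite lin //; last exact: pY.1.
  by rewrite mulN1r -/(gf L W' Y u) -/(gf L W Y u) gWW' // addNr.
(* Expanding one argument of g(d, d), with d = W - W' at u, pairs d with the pi-vector fields W' and
   W, so both terms vanish. *)
by rewrite lin // sym // gd // (sym _ (W u)) // gd // mulr0 addr0 ltxx.
Qed.

(** * Metrics differing by a positive constant, and their Cartan connection *)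

(** The relation is symmetric up to c and 1/c, so one implication per class suffices. *)
Definition rescaled (c : R) L L' :=
  [/\ 0 < c, finsler L, finsler L'
    & forall u v w, fmetric L' u v w = c * fmetric L u v w].

Lemma rescaled_sym c L L' : rescaled c L L' -> rescaled c^-1 L' L.
Proof.
move=> [c0 fL fL' H]; split; [by rewrite invr_gt0|exact: fL'|exact: fL|].
by move=> u v w; rewrite H mulKf // gt_eqF.
Qed.

Lemma gf_rescaled c L L' X Y u : rescaled c L L' ->
  gf L' X Y u = c * gf L X Y u.
Proof. by case=> _ _ _; apply. Qed.

Lemma is_cartan_rescaled c L L' D : rescaled c L L' ->
  is_cartan L D -> is_cartan L' D.
Proof.
move=> H [D1 D2 D3 D4 D5]; split; [exact: D1|exact: D2| |exact: D4|].
  move=> X Y Z vX pY pZ u.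
  rewrite (_ : gf L' Y Z = fun w => c * gf L Y Z w); last first.
    by apply/funext => w; exact: gf_rescaled.
  rewrite !(gf_rescaled _ _ _ H) -mulrDr -D3 //.
  (* The derivation X u commutes with the factor c on smooth functions, so g(Y, Z) has to be
     smooth. *)
  apply: derivation_at_scale (vX.1 u) _.
  by case: H => _ [_ _ _ [_ _ _ sg]] _ _; exact: sg.
move=> X Y Z pX pY pZ u; rewrite !(gf_rescaled _ _ _ H).
exact: congr1 (D5 _ _ _ pX pY pZ u).
Qed.

(* [cartan] is a choice function on the set of Cartan connections, and the
   defining equations are homogeneous in the metric, so that set is unchanged. *)
Lemma cartan_rescaled c L L' : rescaled c L L' -> cartan L' = cartan L.
Proof.
move=> H; have E : is_cartan L' = is_cartan L.
  apply/funext => D; apply/propext; split.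
    exact: is_cartan_rescaled (rescaled_sym H).
  exact: is_cartan_rescaled H.
by rewrite /cartan E.
Qed.

(** * Behaviour of the tensors under rescaling *)

Lemma T3_rescaled c L L' X Y Z u : rescaled c L L' ->
  T3 L' X Y Z u = c * T3 L X Y Z u.
Proof. by move=> H; rewrite /T3 (gf_rescaled _ _ _ H) (cartan_rescaled H). Qed.

Lemma R4_rescaled c L L' X Y Z W u : rescaled c L L' ->
  R4 L' X Y Z W u = c * R4 L X Y Z W u.
Proof. by move=> H; rewrite /R4 (gf_rescaled _ _ _ H) (cartan_rescaled H). Qed.

Lemma P4_rescaled c L L' X Y Z W u : rescaled c L L' ->
  P4 L' X Y Z W u = c * P4 L X Y Z W u.
Proof. by move=> H; rewrite /P4 (gf_rescaled _ _ _ H) (cartan_rescaled H). Qed.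

Lemma Lf_rescaled c L L' u : rescaled c L L' ->
  Lf L' u ^+ 2 = c * Lf L u ^+ 2.
Proof. by case=> _ fL fL' H; rewrite -!fmetric_vec. Qed.

Lemma hbar_rescaled c L L' X Y u : rescaled c L L' ->
  hbar L' X Y u = c * hbar L X Y u.
Proof.
move=> H; have L2 := Lf_rescaled u H; rewrite /hbar /ell !(gf_rescaled _ _ _ H).
case: H => c0 [_ Lp _ _] [_ Lp' _ _] _.
move: (Lp u) (Lp' u) L2; move: (Lf L u) (Lf L' u) (gf L X Y u).
move: (gf L X _ u) (gf L Y _ u) => x y l l' xy l0 l'0 L2.
(* The two factors 1/L' merge into 1/L'^2, so no square root of c enters. *)
rewrite mulrACA -invfM -expr2 L2; field.
by rewrite !gt_eqF.
Qed.

Lemma phi_rescaled c L L' X : rescaled c L L' -> phi L' X = phi L X.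
Proof.
move=> H; apply/funext => u; have L2 := Lf_rescaled u H.
rewrite /phi /ell (gf_rescaled _ _ _ H) !mulrA -!invfM -!expr2 L2.
suff -> : (c * Lf L u ^+ 2)^-1 * c = (Lf L u ^+ 2)^-1 by [].
case: H => c0 [_ Lp _ _] _ _; move: (Lf L u) (Lp u) => l l0; field.
by rewrite !gt_eqF.
Qed.

Lemma Rich_rescaled c L L' X Y : rescaled c L L' -> Rich L' X Y = Rich L X Y.
Proof. by move=> H; rewrite /Rich (cartan_rescaled H). Qed.

(** If W represents Ric^h(X, .) for g, then W/c represents it for c g, and nondegeneracy identifies
    the chosen fields. If no representative exists for one metric, none exists for the other, and
    both choices default to 0. *)
Lemma Rich0_rescaled c L L' X : rescaled c L L' ->
  Rich0 L' X = fun u => c^-1 *: Rich0 L X u.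
Proof.
pose S N : set (slit M -> tvec M) := [set W | pifield W /\
  forall Y, pifield Y -> forall u, gf N W Y u = Rich N X Y u].
have sub d N N' W : rescaled d N N' -> S N W -> S N' (fun u => d^-1 *: W u).
  move=> H [pW WR]; split=> [|Y pY u]; first exact: pifield_scale.
  rewrite (gf_rescaled _ _ _ H) (Rich_rescaled _ _ H) -WR //.
  case: H => d0 fN _ _; rewrite /gf fmetric_scale //; [|exact: pW.1|exact: pY.1].
  by rewrite mulrA mulfV ?mul1r // gt_eqF.
have R0 N : ~ (exists W, S N W) -> Rich0 N X = fun _ => 0.
  by move=> nS; apply: xgetPN => W SW; apply: nS; exists W.
have R1 N W : S N W -> S N (Rich0 N X) by exact: xgetI.
move=> H; have [c0 fL fL' _] := H.
have [[W SW]|nS] := pselect (exists W, S L W).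
  have [pW gW] := sub _ _ _ _ H (R1 _ _ SW).
  have [pV gV] := R1 _ _ (sub _ _ _ _ H SW).
  apply: (gf_inj fL' pV pW) => Y pY u.
  exact: etrans (gV Y pY u) (esym (gW Y pY u)).
have nS' : ~ exists W, S L' W.
  move=> [W SW]; apply: nS; exists (fun u => c^-1^-1 *: W u).
  exact: sub (rescaled_sym H) SW.
rewrite (R0 _ nS) (R0 _ nS').
by apply/funext => u; rewrite scaler0.
Qed.

Lemma Sch_rescaled c L L' u : rescaled c L L' -> Sch L' u = c^-1 * Sch L u.
Proof.
move=> H; rewrite /Sch -trace_scale; last by case: H => c0 _ _ _; rewrite invr_eq0 gt_eqF.
by congr (trace _ u); apply/funext => X; exact: Rich0_rescaled.
Qed.

Lemma Ften_rescaled c L L' X Y u : rescaled c L L' ->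
  Ften L' X Y u = Ften L X Y u.
Proof.
move=> H; rewrite /Ften (Rich_rescaled _ _ H) (Sch_rescaled _ H).
rewrite (gf_rescaled _ _ _ H) mulrACA mulVf ?mul1r //.
by case: H => c0 _ _ _; rewrite gt_eqF.
Qed.

(** * Invariance of each class of Finsler manifolds *)

Lemma P2_like_rescaled c L L' : rescaled c L L' -> P2_like L -> P2_like L'.
Proof.
move=> H [n3 [a [a1 a0 aP]]]; split; first exact: n3.
(* The same form alpha serves, since P and T both acquire the factor c once lowered with the
   metric. *)
exists a; split; [exact: a1|exact: a0|move=> X Y Z W pX pY pZ pW u].
rewrite (P4_rescaled _ _ _ _ _ H) !(T3_rescaled _ _ _ _ H).
rewrite (aP X Y Z W pX pY pZ pW u).
have E (x y s t : R) : c * (x * s - y * t) = x * (c * s) - y * (c * t) by ring.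
exact: E.
Qed.

Lemma h_isotropic_rescaled c L L' : rescaled c L L' ->
  h_isotropic L -> h_isotropic L'.
Proof.
move=> H [n3 [k sk kP]]; split; first exact: n3.
exists (fun u => c^-1 * k u); first exact: smooth_slit_scale.
move=> X Y Z pX pY pZ u; rewrite (cartan_rescaled H).
rewrite (kP X Y Z pX pY pZ u) !(gf_rescaled _ _ _ H).
have E (d x y : R) (v w : tvec M) :
    d *: (x *: v - y *: w) = (c^-1 * d) *: ((c * x) *: v - (c * y) *: w).
  rewrite -!scalerA -scalerBr !scalerA mulrAC mulVf ?mul1r //.
  by case: H => c0 _ _ _; rewrite gt_eqF.
exact: E.
Qed.

(** The lowered curvature gains c while L^2 hbar gains c^2, so k is divided by c. *)
Lemma has_curvature_rescaled c L L' k : rescaled c L L' ->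
  has_curvature L k -> has_curvature L' (fun u => c^-1 * k u).
Proof.
move=> H kP X Y pX pY u; rewrite (R4_rescaled _ _ _ _ _ H) (kP X Y pX pY u).
rewrite (hbar_rescaled _ _ _ H) (Lf_rescaled _ H).
case: H => c0 _ _ _; move: (hbar L X Y u) (Lf L u) => h l; field.
by rewrite gt_eqF.
Qed.

Lemma constant_curvature_rescaled c L L' : rescaled c L L' ->
  constant_curvature L -> constant_curvature L'.
Proof.
move=> H [n3 [k kP]]; split; first exact: n3.
by exists (c^-1 * k); exact: has_curvature_rescaled H kP.
Qed.

Lemma scalar_curvature_rescaled c L L' : rescaled c L L' ->
  scalar_curvature L -> scalar_curvature L'.
Proof.
move=> H [n3 [k sk kP]]; split; first exact: n3.
exists (fun u => c^-1 * k u); first exact: smooth_slit_scale.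
exact: has_curvature_rescaled H kP.
Qed.

Lemma p_scalar_curvature_rescaled c L L' : rescaled c L L' ->
  p_scalar_curvature L -> p_scalar_curvature L'.
Proof.
move=> H [k sk kP]; exists (fun u => c^-1 * k u); first exact: smooth_slit_scale.
move=> X Y Z W pX pY pZ pW u.
rewrite (R4_rescaled _ _ _ _ _ H) !(phi_rescaled _ H).
rewrite (kP X Y Z W pX pY pZ pW u) !(hbar_rescaled _ _ _ H).
have E (d x y s t : R) : c * (d * (x * y - s * t)) =
    c^-1 * d * ((c * x) * (c * y) - (c * s) * (c * t)).
  by case: H => c0 _ _ _; field; rewrite gt_eqF.
exact: E.
Qed.

Lemma s_ps_curvature_rescaled c L L' : rescaled c L L' ->
  s_ps_curvature L -> s_ps_curvature L'.
Proof.
move=> H [sL pL]; split; first exact: scalar_curvature_rescaled H sL.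
exact: p_scalar_curvature_rescaled H pL.
Qed.

Lemma R3_like_rescaled c L L' : rescaled c L L' -> R3_like L -> R3_like L'.
Proof.
move=> H [n4 RP]; split; first exact: n4.
move=> X Y Z W pX pY pZ pW u.
rewrite (R4_rescaled _ _ _ _ _ H) (RP X Y Z W pX pY pZ pW u).
rewrite !(gf_rescaled _ _ _ H) !(Ften_rescaled _ _ _ H).
have E (x1 y1 x2 y2 x3 y3 x4 y4 : R) :
    c * (x1 * y1 - x2 * y2 + x3 * y3 - x4 * y4) =
    c * x1 * y1 - c * x2 * y2 + c * x3 * y3 - c * x4 * y4 by ring.
exact: E.
Qed.

(** The Berwald connection, its curvature and [beta] are all built from the Cartan connection
    alone. *)
Lemma symmetric_rescaled c L L' : rescaled c L L' ->
  symmetric_finsler L -> symmetric_finsler L'.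
Proof.
by move=> H; rewrite /symmetric_finsler /Rberwald /berwald (cartan_rescaled H).
Qed.

Lemma P_symmetric_rescaled c L L' : rescaled c L L' ->
  P_symmetric L -> P_symmetric L'.
Proof. by move=> H; rewrite /P_symmetric (cartan_rescaled H). Qed.

Lemma homothetic_rescaled (sigma : M -> R) L L' : finsler L -> finsler L' ->
  conformal sigma L L' -> homothetic sigma -> exists c, rescaled c L L'.
Proof.
move=> fL fL' [_ _ gg] [s sE]; exists (expR (2 * s)).
split; [exact: expR_gt0|exact: fL|exact: fL'|].
move=> u v w; rewrite -(sE (base u)).
have [[tv tw]|nt] := pselect (tangent (base u) v /\ tangent (base u) w).
  exact: gg.
(* Off the fibre both metrics are extended by 0. *)
by rewrite /fmetric asboolF // mulr0.
Qed.

End Finsler.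

Theorem proposition3p30 (R : realType) (n : nat) (M : manifold R n)
    (L Lt : M -> tvec M -> R) (sigma : M -> R)
    (hL : finsler L) (hLt : finsler Lt)
    (hconf : conformal sigma L Lt) (hhom : homothetic sigma) :
  (P2_like L <-> P2_like Lt) /\
  (h_isotropic L <-> h_isotropic Lt) /\
  (constant_curvature L <-> constant_curvature Lt) /\
  (p_scalar_curvature L <-> p_scalar_curvature Lt) /\
  (s_ps_curvature L <-> s_ps_curvature Lt) /\
  (R3_like L <-> R3_like Lt) /\
  (symmetric_finsler L <-> symmetric_finsler Lt) /\
  (P_symmetric L <-> P_symmetric Lt).
Proof.
have [c H] := homothetic_rescaled hL hLt hconf hhom.
have H' := rescaled_sym H.
split; first by split; [exact: P2_like_rescaled H|exact: P2_like_rescaled H'].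
split; first by split; [exact: h_isotropic_rescaled H|exact: h_isotropic_rescaled H'].
split; first by split; [exact: constant_curvature_rescaled H|exact: constant_curvature_rescaled H'].
split; first by split; [exact: p_scalar_curvature_rescaled H|exact: p_scalar_curvature_rescaled H'].
split; first by split; [exact: s_ps_curvature_rescaled H|exact: s_ps_curvature_rescaled H'].
split; first by split; [exact: R3_like_rescaled H|exact: R3_like_rescaled H'].
split; first by split; [exact: symmetric_rescaled H|exact: symmetric_rescaled H'].
by split; [exact: P_symmetric_rescaled H|exact: P_symmetric_rescaled H'].
Qed.
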